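(* Let $H$ be a crossed homomorphism from a Lie algebra $\mathfrak g$ to a Lie algebra $\mathfrak h$ with respect to an action $\rho$. If two linear deformations $H^1_t=H+t\mathfrak H_1$ and $H^2_t=H+t\mathfrak H_2$ of $H$ are equivalent, then $\mathfrak H_1$ and $\mathfrak H_2$ are in the same cohomology class of $\mathcal H^1(\mathfrak g,\mathfrak h)=\mathcal Z^1(\mathfrak g,\mathfrak h)/\mathcal B^1(\mathfrak g,\mathfrak h)$, the first cohomology group for the crossed homomorphism $H$.
   Context: All vector spaces are over an algebraically closed field $\mathbb K$ of characteristic $0$. An action of $\mathfrak g$ on $\mathfrak h$ is a Lie algebra homomorphism $\rho:\mathfrak g\to\mathrm{Der}(\mathfrak h)$. A crossed homomorphism with respect to $\rho$ is a linear map $H:\mathfrak g\to\mathfrak h$ with $H[x,y]_{\mathfrak g}=\rho(x)(Hy)-\rho(y)(Hx)+[Hx,Hy]_{\mathfrak h}$ for all $x,y\in\mathfrak g$. A homomorphism from a crossed homomorphism $H'$ to a crossed homomorphism $H$ (both with respect to $\rho$) is a pair of Lie algebra homomorphisms $\phi_{\mathfrak g}:\mathfrak g\to\mathfrak g$, $\phi_{\mathfrak h}:\mathfrak h\to\mathfrak h$ with $H\circ\phi_{\mathfrak g}=\phi_{\mathfrak h}\circ H'$ and $\phi_{\mathfrak h}(\rho(y)u)=\rho(\phi_{\mathfrak g}(y))(\phi_{\mathfrak h}(u))$ for all $y\in\mathfrak g,u\in\mathfrak h$. For a linear map $\mathfrak H:\mathfrak g\to\mathfrak h$, $H+t\mathfrak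 H$ is a linear deformation of $H$ if it is a crossed homomorphism with respect to $\rho$ for all $t$. Linear deformations $H^1_t$ and $H^2_t$ are equivalent if there exists $x\in\mathfrak g$ such that $(\mathrm{Id}_{\mathfrak g}+t\,\mathrm{ad}_x,\mathrm{Id}_{\mathfrak h}+t\rho(x))$ is a homomorphism from $H^2_t$ to $H^1_t$ (for all $t$). The cohomology of $H$ is the cohomology of the complex $(\oplus_{k\ge0}\mathrm{Hom}(\wedge^k\mathfrak g,\mathfrak h),d_{\rho_H})$, where $d_{\rho_H}$ is the Chevalley-Eilenberg coboundary operator of the representation $\rho_H(x)u=\rho(x)u+[Hx,u]_{\mathfrak h}$ of $\mathfrak g$ on $\mathfrak h$; $\mathcal Z^k$, $\mathcal B^k$ denote $k$-cocycles and $k$-coboundaries and $\mathcal H^k=\mathcal Z^k/\mathcal B^k$. *)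

(* Defs.v *)
From HB Require Import structures.
From mathcomp Require Import all_boot all_order all_algebra.
From mathcomp Require Import classical_sets.
Set Implicit Arguments.
Unset Strict Implicit.
Unset Printing Implicit Defensive.
Import GRing.Theory.
Local Open Scope ring_scope.
Local Open Scope classical_set_scope.

Reserved Notation "[[ x , y ]]" (at level 0, x, y at level 99,
  format "[[ x ,  y ]]").

HB.mixin Record isLieAlgebra (K : comNzRingType) L of GRing.Lmodule K L := {
  lie_bracket : L -> L -> L;
  lie_bracketPl : forall (a : K) (x y z : L),
    lie_bracket (a *: x + y) z = a *: lie_bracket x z + lie_bracket y z;
  lie_bracketPr : forall (a : K) (x y z : L),
    lie_bracket z (a *: x + y) = a *: lie_bracket z x + lie_bracket z y;
  lie_bracketxx : forall x : L, lie_bracket x x = 0;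
  lie_jacobi : forall x y z : L,
    lie_bracket x (lie_bracket y z) + lie_bracket y (lie_bracket z x)
      + lie_bracket z (lie_bracket x y) = 0
}.

#[short(type="lieType")]
HB.structure Definition LieAlgebra (K : comNzRingType) :=
  {L of isLieAlgebra K L & GRing.Lmodule K L}.

Notation "[[ x , y ]]" := (lie_bracket x y) : ring_scope.

Section LieAlgebras.
Variables (K : comNzRingType) (g h : lieType K).

Definition lie_hom (f : g -> h) : Prop :=
  linear f /\ forall x y, f [[x, y]] = [[f x, f y]].

Definition derivation (D : h -> h) : Prop :=
  linear D /\ forall u v, D [[u, v]] = [[D u, v]] + [[u, D v]].

(* Lie algebra homomorphisms g -> Der(h), the bracket of Der(h) being the
   commutator. *)
Definition lie_action (rho : g -> h -> h) : Prop :=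
  [/\ forall x, derivation (rho x),
      forall (a : K) x y u, rho (a *: x + y) u = a *: rho x u + rho y u
    & forall x y u, rho [[x, y]] u = rho x (rho y u) - rho y (rho x u)].

End LieAlgebras.

Section CrossedHomomorphisms.
Variables (K : comNzRingType) (g h : lieType K) (rho : g -> h -> h).

Definition crossed_hom (H : {linear g -> h}) : Prop :=
  forall x y, H [[x, y]] = rho x (H y) - rho y (H x) + [[H x, H y]].

Definition crossed_hom_morphism (H' H : {linear g -> h})
    (phig : g -> g) (phih : h -> h) : Prop :=
  [/\ lie_hom phig, lie_hom phih,
      forall y, H (phig y) = phih (H' y)
    & forall y u, phih (rho y u) = rho (phig y) (phih u)].

Definition deform (H F : {linear g -> h}) (t : K) : {linear g -> h} :=
  H \+ (t \*: F).

Definition linear_deformation (H F : {linear g -> h}) : Prop :=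
  forall t, crossed_hom (deform H F t).

Definition equivalent_deformations (H F1 F2 : {linear g -> h}) : Prop :=
  exists x : g, forall t : K,
    crossed_hom_morphism (deform H F2 t) (deform H F1 t)
      (fun y => y + t *: [[x, y]]) (fun u => u + t *: rho x u).

Definition rho_twist (H : g -> h) (x : g) (u : h) : h := rho x u + [[H x, u]].

End CrossedHomomorphisms.

Section ChevalleyEilenberg.
Variables (K : comNzRingType) (g : lieType K) (V : lmodType K).
Variable theta : g -> V -> V.

Definition setarg k (v : {ffun 'I_k -> g}) (i : 'I_k) (x : g) :
    {ffun 'I_k -> g} :=
  [ffun j => if j == i then x else v j].

(* Hom(Lambda^k g, V), as alternating k-linear maps. *)
Definition cochains k : set ({ffun 'I_k -> g} -> V) :=
  [set f | (forall (v : {ffun 'I_k -> g}) (i : 'I_k) (a : K) (x y : g),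
              f (setarg v i (a *: x + y))
                = a *: f (setarg v i x) + f (setarg v i y))
         /\ (forall (v : {ffun 'I_k -> g}) (i j : 'I_k),
              i != j -> v i = v j -> f v = 0)].

Definition omit1 k (v : {ffun 'I_k.+1 -> g}) (i : 'I_k.+1) :
    {ffun 'I_k -> g} :=
  [ffun m => v (lift i m)].

(* For i < j, the family [v i, v j], v 0, .., v k with the entries i and j of
   v left out: m |-> bump j (bump i m) enumerates the indices other than i
   and j. *)
Definition bracket2 k (v : {ffun 'I_k.+1 -> g}) (i j : 'I_k.+1) :
    {ffun 'I_k -> g} :=
  [ffun m : 'I_k => if m == 0 :> nat then [[v i, v j]]
                    else v (inord (bump j (bump i m.-1)))].

(* Indices start at 0, so the usual sign (-1)^(i+1) of the first sum becomes
   (-1)^i; the parity of i + j is unaffected. *)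
Definition ce_diff k (f : {ffun 'I_k -> g} -> V) (v : {ffun 'I_k.+1 -> g}) : V :=
  \sum_(i < k.+1) (-1) ^+ i *: theta (v i) (f (omit1 v i))
  + \sum_(i < k.+1) \sum_(j < k.+1 | (i < j)%N)
      (-1) ^+ (i + j) *: f (bracket2 v i j).

Definition cocycles k : set ({ffun 'I_k -> g} -> V) :=
  [set f | cochains f /\ ce_diff f = fun=> 0].

Definition coboundaries k : set ({ffun 'I_k -> g} -> V) :=
  match k with
  | 0 => [set fun=> 0]
  | k'.+1 => [set ce_diff f | f in @cochains k']
  end.

Definition cohomology_class k (f : {ffun 'I_k -> g} -> V) :
    set ({ffun 'I_k -> g} -> V) :=
  [set f' | cocycles f' /\ coboundaries (f' \- f)].

(* The quotient Z^k / B^k, as the set of its cosets. *)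
Definition cohomology k : set (set ({ffun 'I_k -> g} -> V)) :=
  [set cohomology_class f | f in @cocycles k].

(* The identification Hom(g, V) = Hom(Lambda^1 g, V). *)
Definition cochain1 (F : g -> V) : {ffun 'I_1 -> g} -> V :=
  fun v => F (v ord0).

End ChevalleyEilenberg.

(* Main.v *)
(** Both the crossed homomorphism equation for [H + t F] and the intertwining
condition of an equivalence are polynomial identities of degree 2 in [t]. Their
linear coefficients say, respectively, that [F] is a 1-cocycle and that
[F2 y - F1 y = H [x, y] - rho x (H y)], which is [- rho_H(y) (H x)] because [H]
is a crossed homomorphism; so [F2 - F1] is the coboundary of [- H x]. *)
Require Import Defs.
From HB Require Import structures.
From mathcomp Require Import all_boot all_order all_algebra.
From mathcomp Require Import boolp classical_sets.
Import GRing.Theory.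
Local Open Scope ring_scope.

Section LieTheory.
Context {K : comNzRingType} {L : lieType K}.
Implicit Types (a : K) (x y z : L).

Lemma lie_bracketDl x y z : [[x + y, z]] = [[x, z]] + [[y, z]].
Proof. by have := lie_bracketPl 1 x y z; rewrite !scale1r. Qed.

Lemma lie_bracketDr x y z : [[z, x + y]] = [[z, x]] + [[z, y]].
Proof. by have := lie_bracketPr 1 x y z; rewrite !scale1r. Qed.

Lemma lie_bracket0l x : [[0, x]] = 0.
Proof. by apply: (addrI [[0, x]]); rewrite -lie_bracketDl !addr0. Qed.

Lemma lie_bracket0r x : [[x, 0]] = 0.
Proof. by apply: (addrI [[x, 0]]); rewrite -lie_bracketDr !addr0. Qed.

Lemma lie_bracketZl a x y : [[a *: x, y]] = a *: [[x, y]].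
Proof. by have := lie_bracketPl a x 0 y; rewrite lie_bracket0l !addr0. Qed.

Lemma lie_bracketZr a x y : [[x, a *: y]] = a *: [[x, y]].
Proof. by have := lie_bracketPr a y 0 x; rewrite lie_bracket0r !addr0. Qed.

Lemma lie_bracketNr x y : [[x, - y]] = - [[x, y]].
Proof. by rewrite -!scaleN1r lie_bracketZr. Qed.

Lemma lie_bracketC x y : [[x, y]] = - [[y, x]].
Proof.
have := lie_bracketxx (x + y).
rewrite lie_bracketDl !lie_bracketDr !lie_bracketxx add0r addr0.
by move/eqP; rewrite addr_eq0 => /eqP.
Qed.

End LieTheory.

(** Subtracting the identities at [t = 1] and [t = -1] cancels [b] and leaves twice [a]. *)
Lemma quadratic_coef1_eq0 (K : fieldType) (V : lmodType K) (a b : V) :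
  2%:R != 0 :> K -> (forall t : K, t *: a + t ^+ 2 *: b = 0) -> a = 0.
Proof.
move=> two_neq0 ab0.
have := congr2 (fun u v => u - v) (ab0 1) (ab0 (-1)).
rewrite /= sqrrN expr1n scaleN1r !scale1r subr0 opprD opprK addrACA subrr addr0.
rewrite -mulr2n -scaler_nat => /eqP.
by rewrite scaler_eq0 (negPf two_neq0) => /eqP.
Qed.

Section LowDegreeCochains.
Context {K : comNzRingType} {g : lieType K} {V : lmodType K}.
Context {theta : g -> V -> V}.

Lemma cochain1_linear (F : {linear g -> V}) : cochains (cochain1 F).
Proof.
split=> [v i a x y | v i j].
- by rewrite /cochain1 /setarg !ffunE (ord1 i) eqxx linearP.
- by rewrite !ord1 eqxx.
Qed.

Lemma ce_diff0 (f : {ffun 'I_0 -> g} -> V) (v : {ffun 'I_1 -> g}) :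
  ce_diff theta f v = theta (v ord0) (f (omit1 v ord0)).
Proof.
rewrite /ce_diff !big_ord1 expr0 scale1r big1 ?addr0 // => j.
by rewrite (ord1 j).
Qed.

Lemma ce_diff1 (F : g -> V) (v : {ffun 'I_2 -> g}) :
  ce_diff theta (cochain1 F) v =
    theta (v ord0) (F (v ord_max)) - theta (v ord_max) (F (v ord0))
      - F [[v ord0, v ord_max]].
Proof.
have -> : ord_max = lift ord0 ord0 :> 'I_2 by apply: val_inj.
rewrite /ce_diff !big_ord_recl !big_ord0 /= !big_mkcond.
rewrite !big_ord_recl !big_ord0 /= /cochain1 /omit1 /bracket2 !ffunE /=.
(* Omitting entry 1 of a pair leaves entry 0. *)
have -> : lift (lift ord0 ord0) ord0 = ord0 :> 'I_2 by apply: val_inj.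
(* Here [bump 0 0] is 1, and no index of ['I_2] exceeds it: only the pair (0, 1) contributes a
   bracket. *)
rewrite [\sum_(j < 2 | (bump 0 0 < j)%N) _]big_pred0; last by case=> -[|[] ].
by rewrite /bump /= !addr0 !add0r add0n !expr1 expr0 scale1r !scaleN1r.
Qed.

(** A vector [u] is a 0-cochain when read as a constant function: with no index in ['I_0],
    multilinearity and alternation hold vacuously. *)
Lemma coboundaries1 (u : V) (f : {ffun 'I_1 -> g} -> V) :
  (forall v, f v = theta (v ord0) u) -> coboundaries theta f.
Proof.
move=> fE; exists (fun=> u); first by split=> v [].
by apply/funext => v; rewrite ce_diff0 fE.
Qed.

End LowDegreeCochains.

Section Deformations.
Context {K : fieldType} {g h : lieType K} {rho : g -> h -> h}.
Hypothesis two_neq0 : 2%:R != 0 :> K.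
Hypothesis rhoP : lie_action rho.
Context {H : {linear g -> h}}.
Hypothesis HP : crossed_hom rho H.

Lemma lie_action_linear x a u v : rho x (a *: u + v) = a *: rho x u + rho x v.
Proof. by case: rhoP => /(_ x)[lin _] _ _; apply: lin. Qed.

Lemma lie_actionD x u v : rho x (u + v) = rho x u + rho x v.
Proof. by have := lie_action_linear x 1 u v; rewrite !scale1r. Qed.

Lemma lie_action0 x : rho x 0 = 0.
Proof. by apply: (addrI (rho x 0)); rewrite -lie_actionD !addr0. Qed.

Lemma lie_actionZ x a u : rho x (a *: u) = a *: rho x u.
Proof. by have := lie_action_linear x a u 0; rewrite lie_action0 !addr0. Qed.

Lemma lie_actionN x u : rho x (- u) = - rho x u.
Proof. by rewrite -!scaleN1r lie_actionZ. Qed.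

(** The cross terms [[[H x, F y]] + [[F x, H y]]] of the expanded bracket are what the twist by [H]
    adds to [rho] in the coboundary of [F]. *)
Lemma linear_deformation_cocycle (F : {linear g -> h}) :
  linear_deformation rho H F -> cocycles (rho_twist rho H) (cochain1 F).
Proof.
move=> defF; split; first exact: cochain1_linear.
apply/funext => v; rewrite ce_diff1 /rho_twist.
move: (v ord0) (v ord_max) => x y.
apply: (quadratic_coef1_eq0 _ _ _ [[F x, F y]] two_neq0) => t.
have := defF t x y; rewrite /deform /= HP.
rewrite !lie_actionD !lie_actionZ !lie_bracketDl.
rewrite !lie_bracketDr !lie_bracketZl !lie_bracketZr.
rewrite (lie_bracketC (F x) (H y)) opprD (addrACA (rho x _)).
(* The terms free of [t] form the equation of [H] itself and cancel. *)
rewrite -(addrA [[H x, H y]]) [RHS]addrACA => /addrI E.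
rewrite !scalerBr !scalerDr opprD addrACA {}E scalerN scalerA -expr2.
by rewrite [LHS]addrAC !addrA subrr.
Qed.

Lemma equivalent_deformations_cohomologous (F1 F2 : {linear g -> h}) :
  equivalent_deformations rho H F1 F2 ->
  coboundaries (rho_twist rho H) (cochain1 F2 \- cochain1 F1).
Proof.
case=> x eqx; apply: (coboundaries1 (- H x)) => v; rewrite /cochain1 /=.
move: (v ord0) => y.
apply/eqP; rewrite -subr_eq0; apply/eqP.
(* The witness is the coefficient of [t ^+ 2] in the right side minus the left side of the
   intertwining condition at [y]. *)
apply: (quadratic_coef1_eq0 _ _ _ (rho x (F2 y) - F1 [[x, y]]) two_neq0) => t.
have -> : rho_twist rho H y (- H x) = - rho y (H x) + [[H x, H y]].
  by rewrite /rho_twist lie_actionN lie_bracketNr -lie_bracketC.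
have [_ _ /(_ y) + _] := eqx t.
rewrite /deform /= !linearD !linearZ /= HP !lie_actionD !lie_actionZ.
rewrite -!addrA !scalerDr !scalerN !scalerA -expr2.
(* Both sides share [H y] and, once [H [[x, y]]] is expanded, [t *: rho x (H y)]. *)
rewrite -!addrA => /addrI; rewrite [RHS]addrCA => /addrI E.
(* Summands 1 and 5 make up the right side of [E]; the other four are the opposite of its left
   side. *)
rewrite !addrA [LHS](ACl ((1*5)*(3*4*2*6))) /= -!opprD -E.
by rewrite !addrA subrr.
Qed.

End Deformations.

Theorem theorem5p12 (K : closedFieldType) (char0 : [pchar K] =i pred0)
    (g h : lieType K) (rho : g -> h -> h) (rhoP : lie_action rho)
    (H : {linear g -> h}) (HP : crossed_hom rho H)
    (F1 F2 : {linear g -> h})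
    (def1 : linear_deformation rho H F1)
    (def2 : linear_deformation rho H F2)
    (equiv12 : equivalent_deformations rho H F1 F2) :
  exists2 c : set ({ffun 'I_1 -> g} -> h),
    cohomology (rho_twist rho H) c & c (cochain1 F1) /\ c (cochain1 F2).
Proof.
have two_neq0 : 2%:R != 0 :> K by have /pcharf0P -> := char0.
have cocycle_F1 := linear_deformation_cocycle two_neq0 rhoP HP _ def1.
exists (cohomology_class (rho_twist rho H) (cochain1 F1)).
  by exists (cochain1 F1).
split; split=> //.
(* The class contains its own representative, the zero difference being the coboundary of 0. *)
- apply: (coboundaries1 0) => v.
  by rewrite /= subrr /rho_twist (lie_action0 rhoP) lie_bracket0r addr0.
- exact: linear_deformation_cocycle.
- exact: equivalent_deformations_cohomologous.
Qed.
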